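(* Let $p\ge 3$ be a prime number, and let $(\alpha_k)_{k\in\mathbb N}$, $(\beta_k)_{k\in\mathbb N}$, $(\gamma_k)_{k\in\mathbb N}$ be sequences in $\mathbb Q_p$ such that $|\alpha_k|_p<p^{-1/(p-1)}$, $|\beta_k|_p<p^{-1/(p-1)}$ and $|\gamma_k|_p<p^{-1/(p-1)}$ for every $k\in\mathbb N$. Let $S$ be the set of all sequences $\mathbf h=(h_n)_{n\in\mathbb N}$ in $\mathbb Q_p$ with $|h_n|_p<p^{-1/(p-1)}$ for every $n\in\mathbb N$ that satisfy, for every $n\in\mathbb N$, $$h_n=\log_p\left[\left(\frac{\exp_p(\alpha_{n+1}+h_{n+1})+\exp_p(\beta_{n+1})}{\exp_p(\gamma_{n+1})+\exp_p(h_{n+1})}\right)\left(\frac{\exp_p(\alpha_{n+2}+h_{n+2})+\exp_p(\beta_{n+2})}{\exp_p(\gamma_{n+2})+\exp_p(h_{n+2})}\right)\right].$$ Then $S$ has at most one element, i.e. $|S|\le 1$.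
   Context: $\mathbb Q_p$ is the field of $p$-adic numbers with the $p$-adic norm $|\cdot|_p$ normalized by $|p|_p=1/p$. The $p$-adic logarithm is $\log_p(x)=\sum_{n=1}^{\infty}(-1)^{n+1}\frac{(x-1)^n}{n}$, which converges for $x\in\mathbb Q_p$ with $|x-1|_p<1$; the $p$-adic exponential is $\exp_p(x)=\sum_{n=0}^{\infty}\frac{x^n}{n!}$, which converges for $x\in\mathbb Q_p$ with $|x|_p<p^{-1/(p-1)}$. $|S|$ denotes the number of elements of the set $S$. *)

(* Defs.v *)
From HB Require Import structures.
From mathcomp Require Import all_boot all_order all_algebra ring_quotient.
From mathcomp Require Import zify ring lra.
From mathcomp Require Import all_classical all_reals all_analysis.

Set Implicit Arguments.
Unset Strict Implicit.
Unset Printing Implicit Defensive.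

Import Order.TTheory GRing.Theory Num.Theory.
Import numFieldNormedType.Exports.

Local Open Scope classical_set_scope.
Local Open Scope ring_scope.

(** The field of p-adic numbers is built as the completion of [rat] for the
    p-adic absolute value: the ring of Cauchy sequences of rationals, modulo the
    ideal of null sequences. *)

Fact dist_triangle_half (l x y d e : rat) :
  `|x - y| <= d -> d < e / 2 -> `|l - y| < e / 2 -> `|l - x| < e.
Proof. by rewrite !ltr_norml ler_norml; lra. Qed.

Fact dist_max_lt (x x' y y' e : rat) : `|x - x'| < e -> `|y - y'| < e ->
  `|Num.max x y - Num.max x' y'| < e.
Proof. by rewrite !ltr_norml; case: (leP x y); case: (leP x' y'); lra. Qed.

Definition ratpabs (p : nat) (x : rat) : rat :=
  if x == 0 then 0
  else p%:Q ^ ((logn p `|denq x|)%:Z - (logn p `|numq x|)%:Z).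

Section RatAbs.
Variables (p : nat) (p_pr : prime p).
Local Notation abs := (ratpabs p).

Let p_gt0 : 0 < p%:Q. Proof. by rewrite ltr0n prime_gt0. Qed.
Let p_gt1 : 1 < p%:Q. Proof. by rewrite ltr1n prime_gt1. Qed.
Let p_neq0 : p%:Q != 0. Proof. by rewrite gt_eqF. Qed.

Lemma ratpabs0 : abs 0 = 0. Proof. by rewrite /ratpabs eqxx. Qed.

Lemma ratpabs_frac (a b : int) : a != 0 -> b != 0 ->
  abs (a%:Q / b%:Q) = p%:Q ^ ((logn p `|b|)%:Z - (logn p `|a|)%:Z).
Proof.
move=> a0 b0; rewrite /ratpabs mulf_eq0 invr_eq0 !intr_eq0 (negPf a0) (negPf b0) /=.
set x := _ / _.
have x0 : x != 0 by rewrite mulf_neq0 ?invr_eq0 ?intr_eq0.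
have E : (numq x * b = a * denq x)%R.
  have /eqP : (numq x)%:Q / (denq x)%:Q = a%:Q / b%:Q by rewrite divq_num_den.
  rewrite eqr_div ?intr_eq0 ?denq_neq0// -!intrM => /eqP/intr_inj.
  by [].
have := congr1 (fun z : int => logn p `|z|) E.
rewrite /= !abszM !lognM ?absz_gt0 ?numq_eq0 ?denq_neq0//.
by move=> h; congr (_ ^ _); lia.
Qed.

Lemma ratpabs_ge0 x : 0 <= abs x.
Proof. by rewrite /ratpabs; case: ifP => // _; rewrite exprz_ge0 // ltW. Qed.

Lemma ratpabs_eq0 x : (abs x == 0) = (x == 0).
Proof.
rewrite /ratpabs; case: ifP => [_|/negP/negP x0]; first by rewrite eqxx.
by apply/negbTE; rewrite expfz_neq0.
Qed.

Lemma ratpabs1 : abs 1 = 1.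
Proof. by rewrite -[1 in LHS]divr1 (@ratpabs_frac 1 1)//= subrr expr0z. Qed.

Lemma ratpabsM x y : abs (x * y) = abs x * abs y.
Proof.
have [->|x0] := eqVneq x 0; first by rewrite !(mul0r, ratpabs0).
have [->|y0] := eqVneq y 0; first by rewrite !(mulr0, ratpabs0).
rewrite -[x in LHS]divq_num_den -[y in LHS]divq_num_den mulf_div -!intrM.
rewrite ratpabs_frac ?mulf_neq0 ?numq_eq0 ?denq_neq0//.
rewrite /ratpabs (negPf x0) (negPf y0) -expfzDr//.
rewrite !abszM !lognM ?absz_gt0 ?numq_eq0 ?denq_neq0//.
by congr (_ ^ _); lia.
Qed.

Lemma ratpabsN x : abs (- x) = abs x.
Proof. by rewrite /ratpabs oppr_eq0 numqN denqN abszN. Qed.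

Lemma ratpabsB x y : abs (x - y) = abs (y - x).
Proof. by rewrite -ratpabsN opprB. Qed.

Lemma ratpabsV x : abs x^-1 = (abs x)^-1.
Proof.
have [->|x0] := eqVneq x 0; first by rewrite !(invr0, ratpabs0).
apply: (@mulfI _ (abs x)); first by rewrite ratpabs_eq0.
by rewrite -ratpabsM !mulfV ?ratpabs_eq0// ratpabs1.
Qed.

Lemma ratpabsD x y : abs (x + y) <= Num.max (abs x) (abs y).
Proof.
have [->|x0] := eqVneq x 0; first by rewrite add0r le_max lexx orbT.
have [->|y0] := eqVneq y 0; first by rewrite addr0 le_max lexx.
have [->|xy0] := eqVneq (x + y) 0; first by rewrite ratpabs0 le_max ratpabs_ge0.
pose d := denq x * denq y; pose a := numq x * denq y; pose b := numq y * denq x.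
have d0 : d != 0 by rewrite mulf_neq0 ?denq_neq0.
have dx0 : (denq x)%:Q != 0 by rewrite intr_eq0 denq_neq0.
have dy0 : (denq y)%:Q != 0 by rewrite intr_eq0 denq_neq0.
have xE : x = a%:Q / d%:Q.
  by rewrite -[LHS]divq_num_den /a /d !intrM; field; rewrite dx0 dy0.
have yE : y = b%:Q / d%:Q.
  by rewrite -[LHS]divq_num_den /b /d !intrM; field; rewrite dx0 dy0.
have sE : x + y = (a + b)%:Q / d%:Q by rewrite [in LHS]xE [in LHS]yE -mulrDl -intrD.
have a0 : a != 0 by rewrite mulf_neq0 ?numq_eq0 ?denq_neq0.
have b0 : b != 0 by rewrite mulf_neq0 ?numq_eq0 ?denq_neq0.
have s0 : a + b != 0 by apply: contraNneq xy0 => h; rewrite sE h mul0r.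
rewrite sE xE yE !ratpabs_frac// le_max !ler_eXz2l//.
suff : (minn (logn p (absz a)) (logn p (absz b)) <= logn p (absz (a + b)%R))%N by lia.
rewrite -pfactor_dvdn// ?absz_gt0//.
set k := (p ^ _)%N; rewrite (_ : (_ %| _)%N = (a + b \in dvdz k))// rpredD//.
- by rewrite [_ \in _]pfactor_dvdn ?absz_gt0// geq_minl.
- by rewrite [_ \in _]pfactor_dvdn ?absz_gt0// geq_minr.
Qed.

Lemma ratpabsD_lt x y e : abs x < e -> abs y < e -> abs (x + y) < e.
Proof. by move=> xe ye; apply: le_lt_trans (ratpabsD x y) _; rewrite gt_max xe. Qed.

Lemma ratpabs_dist x y : `|abs x - abs y| <= abs (x - y).
Proof.
have := ratpabsD (x - y) y; have := ratpabsD (y - x) x.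
rewrite !subrK (ratpabsB y) !le_max ler_norml => h1 h2.
have := ratpabs_ge0 x; have := ratpabs_ge0 y; have := ratpabs_ge0 (x - y).
by case/orP: h1 => h1; case/orP: h2 => h2; lra.
Qed.

Lemma ratpabs_close x y : abs (x - y) < abs x -> abs y = abs x.
Proof.
move=> h; apply/eqP; rewrite eq_le.
have /orP h1 : (abs x <= abs (x - y)) || (abs x <= abs y).
  by rewrite -le_max -[x in abs x](subrK y) ratpabsD.
have /orP h2 : (abs y <= abs (x - y)) || (abs y <= abs x).
  by rewrite -le_max ratpabsB -[y in abs y](subrK x) ratpabsD.
by apply/andP; split; [case: h2|case: h1] => //; lra.
Qed.

End RatAbs.

Definition padic_cauchy (p : nat) : {pred nat -> rat} :=
  fun u => `[< forall e : rat, 0 < e -> exists N : nat,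
    forall m n : nat, (N <= m)%N -> (N <= n)%N -> ratpabs p (u m - u n) < e >].

Definition padic_null (p : nat) (u : nat -> rat) : Prop :=
  forall e : rat, 0 < e -> exists N : nat,
    forall n : nat, (N <= n)%N -> ratpabs p (u n) < e.

Section CauchySequences.
Variables (p : nat) (p_pr : prime p).
Local Notation abs := (ratpabs p).

Lemma padic_cauchy_bounded (u : nat -> rat) : u \in padic_cauchy p ->
  exists2 M : rat, 0 < M & exists N, forall n, (N <= n)%N -> abs (u n) < M.
Proof.
move=> /asboolP/(_ 1 ltr01)[N hN]; exists (abs (u N) + 1).
  by rewrite ltr_wpDl ?ratpabs_ge0.
exists N => n Nn; have := hN _ _ Nn (leqnn _).
by have := ratpabs_dist p_pr (u n) (u N); rewrite ler_norml; lra.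
Qed.

Lemma padic_cauchy_nonnull (u : nat -> rat) : u \in padic_cauchy p ->
  ~ padic_null p u ->
  exists2 r : rat, 0 < r & exists N, forall n, (N <= n)%N -> abs (u n) = r.
Proof.
move=> /asboolP uC /existsNP[e /not_implyP[e0 /forallNP ue]].
have [N hN] := uC e e0.
have /existsNP[n /not_implyP[Nn /negP]] := ue N.
rewrite -leNgt => en; exists (abs (u n)); first exact: lt_le_trans en.
exists N => m Nm; apply: (ratpabs_close p_pr); apply: lt_le_trans en.
exact: hN.
Qed.

Fact padic_cauchy_subring : subring_closed (padic_cauchy p).
Proof.
split=> [|u v uC vC|u v uC vC].
- apply/asboolP => e e0; exists 0%N => m n _ _.
  by rewrite subrr ratpabs0.
- move: uC vC => /asboolP uC /asboolP vC; apply/asboolP => e e0.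
  have [N1 h1] := uC e e0; have [N2 h2] := vC e e0.
  exists (maxn N1 N2) => m n; rewrite !geq_max => /andP[m1 m2] /andP[n1 n2].
  rewrite (_ : (u - v) m - (u - v) n = (u m - u n) + (v n - v m)); last first.
    by rewrite -[(u - v) m]/(u m - v m) -[(u - v) n]/(u n - v n); ring.
  by apply: ratpabsD_lt => //; [exact: h1|exact: h2].
- have [M M0 [N1 h1]] := padic_cauchy_bounded uC.
  have [L L0 [N2 h2]] := padic_cauchy_bounded vC.
  move: uC vC => /asboolP uC /asboolP vC; apply/asboolP => e e0.
  have [N3 h3] := uC (e / L) (divr_gt0 e0 L0).
  have [N4 h4] := vC (e / M) (divr_gt0 e0 M0).
  exists (maxn (maxn N1 N2) (maxn N3 N4)) => m n.
  rewrite !geq_max => /andP[/andP[m1 m2] /andP[m3 m4]].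
  move=> /andP[/andP[n1 n2] /andP[n3 n4]].
  rewrite (_ : (u * v) m - (u * v) n = (u m - u n) * v m + u n * (v m - v n));
    last first.
    by rewrite -[(u * v) m]/(u m * v m) -[(u * v) n]/(u n * v n); ring.
  apply: ratpabsD_lt => //; rewrite ratpabsM//.
    rewrite -(divfK (lt0r_neq0 L0) e) ltr_pM ?ratpabs_ge0//.
      exact: h3.
    exact: h2.
  rewrite -(divfK (lt0r_neq0 M0) e) mulrC ltr_pM ?ratpabs_ge0//.
    exact: h4.
  exact: h1.
Qed.

HB.instance Definition _ :=
  GRing.isSubringClosed.Build (nat -> rat) (padic_cauchy p) padic_cauchy_subring.

End CauchySequences.

Record padic_seq (p : nat) (p_pr : prime p) := PadicSeq {
  padic_seq_val :> nat -> rat;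
  padic_seqP : padic_seq_val \in padic_cauchy p }.

HB.instance Definition _ p (p_pr : prime p) := [isSub for @padic_seq_val p p_pr].
HB.instance Definition _ p (p_pr : prime p) := [Choice of padic_seq p_pr by <:].
HB.instance Definition _ p (p_pr : prime p) :=
  GRing.SubChoice_isSubComNzRing.Build _ _ (padic_seq p_pr)
    (padic_cauchy_subring p_pr).

Definition padic_null_ideal (p : nat) (p_pr : prime p) (u : padic_seq p_pr) : bool :=
  `[< padic_null p u >].

Section NullIdeal.
Variables (p : nat) (p_pr : prime p).

Fact padic_null_idealr : idealr_closed (@padic_null_ideal p p_pr).
Proof.
split.
- by apply/asboolP => e e0; exists 0%N => n _; rewrite ratpabs0.
- apply/asboolP => /(_ 1 ltr01)[N /(_ _ (leqnn N))].
  by rewrite ratpabs1// ltxx.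
- move=> a u v /asboolP uZ /asboolP vZ; apply/asboolP => e e0.
  have [M M0 [N1 h1]] := padic_cauchy_bounded p_pr (padic_seqP a).
  have [N2 h2] := uZ (e / M) (divr_gt0 e0 M0); have [N3 h3] := vZ e e0.
  exists (maxn N1 (maxn N2 N3)) => n; rewrite !geq_max => /and3P[n1 n2 n3].
  apply: (ratpabsD_lt p_pr); last exact: h3.
  rewrite -[X in ratpabs p X]/(a n * u n) ratpabsM//.
  rewrite -(divfK (lt0r_neq0 M0) e) mulrC ltr_pM ?ratpabs_ge0//.
    exact: h2.
  exact: h1.
Qed.

HB.instance Definition _ :=
  isIdealr.Build (padic_seq p_pr) (@padic_null_ideal p p_pr) padic_null_idealr.

End NullIdeal.

Definition padic (p : nat) (p_pr : prime p) : Type :=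
  {ideal_quot (@padic_null_ideal p p_pr : idealr (padic_seq p_pr))}.

HB.instance Definition _ p (p_pr : prime p) := GRing.ComNzRing.on (padic p_pr).
HB.instance Definition _ p (p_pr : prime p) := isPointed.Build (padic p_pr) 0.
HB.instance Definition _ p (p_pr : prime p) := NzRingQuotient.on (padic p_pr).

Section PadicField.
Variables (p : nat) (p_pr : prime p).
Local Notation abs := (ratpabs p).
Local Notation Q_p := (padic p_pr).
Local Open Scope quotient_scope.

Lemma padic_pi_eq (u v : padic_seq p_pr) :
  (\pi_Q_p u = \pi_Q_p v) <-> padic_null p (u - v : padic_seq p_pr).
Proof.
split=> [/eqP|h].
  by rewrite -[_ == _]Quotient.idealrBE => /asboolP.
by apply/eqP; rewrite -[_ == _]Quotient.idealrBE; apply/asboolP.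
Qed.

Fact padic_has_inverse (x : Q_p) : x != 0 -> exists y : Q_p, y * x = 1.
Proof.
rewrite -[x]reprK; set u := repr x => /eqP u0.
have uN : ~ padic_null p u.
  move=> h; apply: u0; rewrite -[0](rmorph0 \pi_Q_p); apply/padic_pi_eq.
  by rewrite subr0.
have [r r0 [N hN]] := padic_cauchy_nonnull p_pr (padic_seqP u) uN.
have vC : (fun n => (u n)^-1) \in padic_cauchy p.
  apply/asboolP => e e0; have /asboolP uC := padic_seqP u.
  have [N' hN'] := uC (e * (r * r)) (mulr_gt0 e0 (mulr_gt0 r0 r0)).
  exists (maxn N N') => m n; rewrite !geq_max => /andP[m1 m2] /andP[n1 n2].
  have um : u m != 0 by rewrite -(ratpabs_eq0 p_pr) hN// gt_eqF.
  have un : u n != 0 by rewrite -(ratpabs_eq0 p_pr) hN// gt_eqF.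
  have -> : (u m)^-1 - (u n)^-1 = (u n - u m) / (u m * u n).
    by field; rewrite um un.
  rewrite ratpabsM// ratpabsV// ratpabsM// !hN// ltr_pdivrMr ?mulr_gt0//.
  exact: hN'.
exists (\pi_Q_p (PadicSeq p_pr vC)).
rewrite -(rmorphM \pi_Q_p) -(rmorph1 \pi_Q_p); apply/padic_pi_eq => e e0.
exists N => n Nn.
have un : u n != 0 by rewrite -(ratpabs_eq0 p_pr) hN// gt_eqF.
rewrite -[X in ratpabs p X]/((u n)^-1 * u n - 1).
by rewrite mulVf// subrr ratpabs0.
Qed.

Definition padic_inv (x : Q_p) : Q_p := xget 0 [set y : Q_p | y * x = 1].

Fact padic_mulVf x : x != 0 -> padic_inv x * x = 1.
Proof.
by move=> /padic_has_inverse[y yx]; rewrite /padic_inv; case: xgetP => // /(_ y).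
Qed.

Fact padic_inv0 : padic_inv 0 = 0.
Proof.
rewrite /padic_inv; case: xgetP => // y _ /= /eqP.
by rewrite mulr0 eq_sym oner_eq0.
Qed.

HB.instance Definition _ :=
  GRing.ComNzRing_isField.Build Q_p padic_mulVf padic_inv0.

(* The values of the p-adic absolute value lie in p^Z and 0, whence the codomain
   [rat]: along a Cauchy sequence the absolute values are eventually constant or
   tend to 0. *)
Definition padic_abs (x : Q_p) : rat := limn (fun n => abs (repr x n) : rat^o).

Lemma cvg_padic_abs (u : padic_seq p_pr) :
  (fun n => abs (u n) : rat^o) @ \oo --> (padic_abs (\pi_Q_p u) : rat^o).
Proof.
have cvg_abs (v : padic_seq p_pr) : cvgn (fun n => abs (v n) : rat^o).
  have [vN|vN] := pselect (padic_null p v).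
    apply/cvg_ex; exists (0 : rat^o); apply/cvgrPdist_lt => e e0.
    have [N hN] := vN e e0; exists N => // n /= Nn.
    by rewrite sub0r normrN ger0_norm ?ratpabs_ge0// hN.
  have [r r0 [N hN]] := padic_cauchy_nonnull p_pr (padic_seqP v) vN.
  apply/cvg_ex; exists (r : rat^o); apply: cvg_near_cst.
  by exists N.
have : padic_null p (u - repr (\pi_Q_p u) : padic_seq p_pr).
  by apply/padic_pi_eq; rewrite reprK.
move=> uN; have /cvgrPdist_lt h := cvg_abs (repr (\pi_Q_p u)).
apply/cvgrPdist_lt => e e0.
have [N1 _ hN1] := h _ (divr_gt0 e0 (ltr0Sn _ 1)).
have [N2 hN2] := uN (e / 2) (divr_gt0 e0 (ltr0Sn _ 1)).
exists (maxn N1 N2) => // n /=; rewrite geq_max => /andP[n1 n2].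
have d1 := ratpabs_dist p_pr (u n) (repr (\pi_Q_p u) n).
exact: dist_triangle_half d1 (hN2 n n2) (hN1 n n1).
Qed.

Lemma padic_abs_lim (u : padic_seq p_pr) (l : rat) :
  (fun n => abs (u n) : rat^o) @ \oo --> (l : rat^o) -> padic_abs (\pi_Q_p u) = l.
Proof.
move=> ul; pose H := @norm_hausdorff rat rat^o.
exact: etrans (esym (cvg_lim H (@cvg_padic_abs u))) (cvg_lim H ul).
Qed.

Lemma padic_abs0 : padic_abs 0 = 0.
Proof.
rewrite -[0](rmorph0 \pi_Q_p); apply: padic_abs_lim; apply: cvg_near_cst.
by apply: nearW => n; rewrite ratpabs0.
Qed.

Lemma padic_absN x : padic_abs (- x) = padic_abs x.
Proof.
rewrite -[x]reprK -(rmorphN \pi_Q_p); apply: padic_abs_lim.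
rewrite (_ : (fun n => _) = (fun n => abs (repr x n))); first exact: cvg_padic_abs.
by apply/funext => n; rewrite -[X in abs X]/(- repr x n) ratpabsN.
Qed.

Lemma padic_absD x y : padic_abs (x + y) <= Num.max (padic_abs x) (padic_abs y).
Proof.
rewrite -[x]reprK -[y]reprK -(rmorphD \pi_Q_p); set u := repr x; set v := repr y.
apply: (@ler_cvg_to _ _ _ rat _ (fun n => Num.max (abs (u n)) (abs (v n)))
  _ _ (@cvg_padic_abs _)); last first.
  by apply: nearW => n; exact: ratpabsD.
apply/cvgrPdist_lt => e e0.
have /cvgrPdist_lt/(_ _ e0)[N1 _ h1] := @cvg_padic_abs u.
have /cvgrPdist_lt/(_ _ e0)[N2 _ h2] := @cvg_padic_abs v.
exists (maxn N1 N2) => // n /=; rewrite geq_max => /andP[n1 n2].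
exact: dist_max_lt (h1 n n1) (h2 n n2).
Qed.

Lemma padic_absM x y : padic_abs (x * y) = padic_abs x * padic_abs y.
Proof.
rewrite -[x]reprK -[y]reprK -(rmorphM \pi_Q_p); apply: padic_abs_lim.
rewrite (_ : (fun n => _) = (fun n => abs (repr x n) * abs (repr y n))).
  by apply: (@cvgM rat); exact: cvg_padic_abs.
by apply/funext => n; rewrite -[X in abs X]/(repr x n * repr y n) ratpabsM.
Qed.

Lemma padic_abs_eq0 x : padic_abs x = 0 -> x = 0.
Proof.
rewrite -[x in padic_abs x]reprK => x0; rewrite -[x]reprK -[0](rmorph0 \pi_Q_p).
apply/padic_pi_eq; rewrite subr0 => e e0.
have := @cvg_padic_abs (repr x); rewrite x0 => /cvgrPdist_lt/(_ e e0)[N _ hN].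
exists N => n Nn; have := hN n Nn.
by rewrite /= sub0r normrN ger0_norm// ratpabs_ge0.
Qed.

Lemma padic_abs_prime : padic_abs p%:R = p%:R^-1.
Proof.
rewrite -(rmorph_nat \pi_Q_p); apply: padic_abs_lim; apply: cvg_near_cst.
apply: nearW => n.
have nat_val k : (k%:R : padic_seq p_pr) n = k%:Q.
  elim: k => [//|k ih]; rewrite -natr1 -[k.+1%:~R](natr1 k).
  by rewrite -[LHS]/((k%:R : padic_seq p_pr) n + 1) ih.
rewrite nat_val -[p%:Q]divr1.
rewrite (@ratpabs_frac p p_pr p 1)//=; last by rewrite eqz_nat -lt0n prime_gt0.
by rewrite logn1 sub0r logn_prime// eqxx -exprN1.
Qed.

Fact padic_distxx x : padic_abs (x - x) = 0.
Proof. by rewrite subrr padic_abs0. Qed.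

Fact padic_dist_eq0 x y : padic_abs (x - y) = 0 -> x = y.
Proof. by move=> /padic_abs_eq0/eqP; rewrite subr_eq0 => /eqP. Qed.

Fact padic_distC x y : padic_abs (x - y) = padic_abs (y - x).
Proof. by rewrite -padic_absN opprB. Qed.

Lemma padic_abs_ge0 x : 0 <= padic_abs x.
Proof.
have := padic_absD x (- x).
by rewrite subrr padic_abs0 padic_absN maxxx.
Qed.

Fact padic_dist_triangle y x z :
  padic_abs (x - z) <= padic_abs (x - y) + padic_abs (y - z).
Proof.
rewrite -[x - z](subrKA y); apply: le_trans (padic_absD _ _) _.
by rewrite ge_max lerDl lerDr !padic_abs_ge0.
Qed.

HB.instance Definition _ := isMetric.Build rat Q_p
  padic_distxx padic_dist_eq0 padic_distC padic_dist_triangle.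

Definition padic_exp (x : Q_p) : Q_p := limn (series (fun n => x ^+ n / n`!%:R)).

Definition padic_log (x : Q_p) : Q_p :=
  limn (fun N => \sum_(1 <= n < N) (-1) ^+ n.+1 * ((x - 1) ^+ n / n%:R)).

(* The open disk of convergence of [padic_exp]; its radius is irrational for
   p > 2, hence the embedding of the absolute value into a [realType]. *)
Definition padic_exp_disk (R : realType) : set Q_p :=
  [set x | ratr (padic_abs x) < p%:R `^ (- 1 / (p%:R - 1)) :> R].

End PadicField.

(* Main.v *)
Require Import Defs.
From mathcomp Require Import all_boot all_order all_algebra ring_quotient.
From mathcomp Require Import zify ring lra.
From mathcomp Require Import all_classical all_reals all_analysis.

Import Order.TTheory GRing.Theory Num.Theory.
Import numFieldNormedType.Exports.

Local Open Scope classical_set_scope.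
Local Open Scope card_scope.
Local Open Scope ring_scope.

(** Points of the disk satisfy |x| <= r := 1/p, since p > 2 and |x| is an integral
    power of p. As v_p(n!) <= (n-1)/2, estimating the power series termwise gives
    |exp x - exp y - (x - y)| <= r |x - y| and |log u - log v| <= |u - v| on that
    disk, where the series converge because Q_p is complete. The first estimate
    makes h |-> (exp (a + h) + exp b) / (exp g + exp h) a contraction of ratio r with
    values in 1 + p Z_p. Two solutions h, h' thus satisfy
    |h_n - h'_n| <= r max (|h_(n+1) - h'_(n+1)|, |h_(n+2) - h'_(n+2)|), and iterating
    from the bound r yields |h_n - h'_n| <= r^k for every k. *)

(** In Legendre's sum for (n+1)! the first quotient is at most (n+1)/3 as p >= 3, and the later
    quotients form the same sum for that quotient; hence an induction. *)
Lemma logn_fact_le p n : (2 < p)%N -> prime p -> (logn p (n.+1)`! <= n./2)%N.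
Proof.
move=> p_gt2 p_pr; rewrite logn_fact//.
(* Doubling avoids the rounded half; the cut-off [K] is independent of [m] so that the induction may
   replace [m.+1] by [m.+1 %/ p]. *)
suff H K m : (2 * \sum_(1 <= k < K.+1) m.+1 %/ p ^ k <= m)%N.
  by have := H n.+1 n; lia.
elim: K m => [|K IH] m; first by rewrite big_nil.
have -> : (\sum_(1 <= k < K.+2) m.+1 %/ p ^ k =
    m.+1 %/ p + \sum_(1 <= k < K.+1) (m.+1 %/ p) %/ p ^ k)%N.
  rewrite big_nat_recl// expn1 big_add1 /= big_add1 /=; congr addn.
  by apply: eq_bigr => k _; rewrite expnS divnMA.
have le3 : (m.+1 %/ p * 3 <= m.+1)%N.
  by rewrite (leq_trans _ (leq_divM m.+1 p))// leq_mul2l p_gt2 orbT.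
case: (m.+1 %/ p)%N le3 => [_|q le3]; first by rewrite big1// => k _; rewrite div0n.
by have := IH q; lia.
Qed.

Lemma sub_mediants (F : fieldType) (A A' B C D D' : F) :
  C + D != 0 -> C + D' != 0 ->
  (A + B) / (C + D) - (A' + B) / (C + D') =
  ((A - A') * (C + D') - (A' + B) * (D - D')) / ((C + D) * (C + D')).
Proof. by move=> CD CD'; field; rewrite CD CD'. Qed.

(** * Ultrametric estimates, density of the rationals, discreteness of the absolute value *)

Section PadicAbs.
Context {p : nat} {p_pr : prime p}.
Local Notation Q_p := (padic p_pr).
Local Notation abs := (@padic_abs p p_pr).
Local Notation r := (p%:R^-1 : rat).
Local Open Scope quotient_scope.

Lemma padic_radius_gt0 : 0 < r.
Proof. by rewrite invr_gt0 ltr0n prime_gt0. Qed.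

Lemma padic_radius_lt1 : r < 1.
Proof. by rewrite invf_lt1 ?ltr1n ?ltr0n ?prime_gt1 ?prime_gt0. Qed.

Lemma padic_radiusX_le m n : (m <= n)%N -> r ^+ n <= r ^+ m.
Proof.
by move=> mn; rewrite ler_wiXn2l// ltW// ?padic_radius_gt0 ?padic_radius_lt1.
Qed.

Lemma padic_radiusX_lt (e : rat) : 0 < e -> exists n, r ^+ n < e.
Proof.
move=> e0; have := archi_boundP (ltW (_ : 0 < e^-1)).
rewrite invr_gt0 e0 => /(_ isT); set N := Num.bound _ => eN; exists N.
rewrite exprVn invf_plt ?posrE ?exprn_gt0 ?ltr0n ?prime_gt0//.
rewrite (lt_trans eN)// -natrX ltr_nat ltn_expl// prime_gt1//.
Qed.

Lemma padic_absB_le (x y : Q_p) e : abs x <= e -> abs y <= e -> abs (x - y) <= e.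
Proof.
by move=> xe ye; apply: le_trans (padic_absD _ _) _; rewrite padic_absN ge_max xe.
Qed.

Lemma padic_absD_le (x y : Q_p) e : abs x <= e -> abs y <= e -> abs (x + y) <= e.
Proof. by move=> xe ye; apply: le_trans (padic_absD _ _) _; rewrite ge_max xe. Qed.

Lemma padic_absD_lt (x y : Q_p) e : abs x < e -> abs y < e -> abs (x + y) < e.
Proof. by move=> xe ye; apply: le_lt_trans (padic_absD _ _) _; rewrite gt_max xe. Qed.

Lemma padic_absB_lt (x y : Q_p) e : abs x < e -> abs y < e -> abs (x - y) < e.
Proof. by move=> xe ye; apply: padic_absD_lt; rewrite ?padic_absN. Qed.

(** Ultrametric triangles are isosceles: if |x| < |y| held, y = x - (x - y) would be smaller than
    itself. *)
Lemma padic_abs_close (x y : Q_p) : abs (x - y) < abs y -> abs x = abs y.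
Proof.
move=> xy; apply/eqP; rewrite eq_le; apply/andP; split.
  by rewrite -[x in abs x](subrK y) padic_absD_le// ltW.
rewrite leNgt; apply/negP => yx; have := padic_absB_lt _ _ _ yx xy.
by rewrite subKr ltxx.
Qed.

Lemma padic_abs_sum_le n (F : nat -> Q_p) (e : rat) : 0 <= e ->
  (forall i, abs (F i) <= e) -> abs (\sum_(0 <= i < n) F i) <= e.
Proof.
move=> e0 Fe; elim: n => [|n IH]; first by rewrite big_nil padic_abs0.
by rewrite big_nat_recr//= padic_absD_le.
Qed.

Lemma padic_cst_cauchy (q : rat) : (fun=> q) \in padic_cauchy p.
Proof. by apply/asboolP => e e0; exists 0%N => m n _ _; rewrite subrr ratpabs0. Qed.

Definition padic_of_rat (q : rat) : Q_p :=
  \pi_Q_p (PadicSeq p_pr (padic_cst_cauchy q)).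

Lemma padic_of_ratB a b : padic_of_rat (a - b) = padic_of_rat a - padic_of_rat b.
Proof. by rewrite /padic_of_rat -(rmorphB \pi_Q_p); congr (\pi_Q_p _); apply: val_inj. Qed.

Lemma padic_of_rat_nat n : padic_of_rat n%:R = n%:R.
Proof.
rewrite -(rmorph_nat \pi_Q_p); congr (\pi_Q_p _); apply: val_inj.
apply/funext => i /=; elim: n => [//|n IH]; rewrite -!natr1 IH.
by [].
Qed.

Lemma padic_abs_rat q : abs (padic_of_rat q) = ratpabs p q.
Proof. by apply: padic_abs_lim; apply: cvg_near_cst; apply: nearW. Qed.

Lemma padic_abs_nat n : (0 < n)%N -> abs n%:R = r ^+ logn p n.
Proof.
move=> n0; rewrite -padic_of_rat_nat padic_abs_rat -[n%:R]divr1.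
rewrite (@ratpabs_frac p p_pr n 1)//=; last by rewrite eqz_nat -lt0n.
by rewrite logn1 sub0r exprVn -exprz_inv -exprnP exprVn.
Qed.

Lemma padic_of_rat_dense (x : Q_p) e : 0 < e ->
  exists q, abs (x - padic_of_rat q) < e.
Proof.
move=> e0; rewrite -[x]reprK; set u := repr x.
have /asboolP uC := padic_seqP u.
have [N hN] := uC _ (divr_gt0 e0 (ltr0Sn _ 1)).
(* The witness is a late term of a Cauchy representative; passing to the limit weakens the strict
   bound, hence [e / 2]. *)
exists (u N); rewrite /padic_of_rat -(rmorphB \pi_Q_p).
apply: (@le_lt_trans _ _ (e / 2)); last by lra.
apply: (@ler_cvg_to _ _ _ rat _ (fun=> e / 2) _ _ (@cvg_padic_abs _ _ _)).
  exact: cvg_cst.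
exists N => // n /= Nn; rewrite -[X in ratpabs p X]/(u n - u N).
by rewrite ltW// hN.
Qed.

(** A rational closer to x than |x| has the same absolute value, which is therefore p^z for an
    integer z; z < 0 means z <= -1. *)
Lemma padic_abs_discrete (x : Q_p) : abs x < 1 -> abs x <= r.
Proof.
move=> x1; have [->|x0] := eqVneq x 0.
  by rewrite padic_abs0 ltW// padic_radius_gt0.
have absx : 0 < abs x.
  rewrite lt_neqAle padic_abs_ge0 andbT eq_sym.
  by apply: contraNneq x0 => /padic_abs_eq0 ->.
have [q] := padic_of_rat_dense x _ absx.
rewrite padic_distC => /padic_abs_close E; move: x1 absx; rewrite -E padic_abs_rat /ratpabs.
case: ifP => [|_]; first by rewrite ltxx.
have p1 : 1 < p%:Q by rewrite ltr1n prime_gt1.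
set z := (_ - _)%R; rewrite -[X in _ < X -> _](expr0z p%:Q) -[r]exprN1.
rewrite ltr_eXz2l// => z0 _.
by rewrite ler_eXz2l//; lia.
Qed.


(** * Completeness and convergence of series *)

Lemma padic_cvgP (u : nat -> Q_p) (l : Q_p) :
  u @ \oo --> l <->
  forall e, 0 < e -> exists N, forall n, (N <= n)%N -> abs (l - u n) < e.
Proof.
split=> [/cvg_ballP ul e e0|ul].
  by have [N _ hN] := ul e e0; exists N => n /hN; rewrite ballEmdist.
apply/cvg_ballP => e e0; have [N hN] := ul e e0.
by exists N => // n /hN; rewrite ballEmdist.
Qed.

(** Rationals [q n] within r^n of [u n] form a Cauchy sequence, whose class is the limit. *)
Lemma padic_complete (u : nat -> Q_p) :
  (forall e, 0 < e -> exists N, forall m n, (N <= m)%N -> (N <= n)%N ->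
    abs (u m - u n) < e) -> cvgn u.
Proof.
move=> uC.
have [q uq] : {q : nat -> rat & forall n, abs (u n - padic_of_rat (q n)) < r ^+ n}.
  apply: (@choice _ _ (fun n s => abs (u n - padic_of_rat s) < r ^+ n)) => n.
  by apply: padic_of_rat_dense; rewrite exprn_gt0 ?padic_radius_gt0.
have uq_small e : 0 < e -> exists N, forall n, (N <= n)%N ->
    abs (u n - padic_of_rat (q n)) < e.
  move=> e0; have [N Ne] := padic_radiusX_lt _ e0.
  by exists N => n Nn; rewrite (lt_trans (uq n))// (le_lt_trans _ Ne)// padic_radiusX_le.
have qC : q \in padic_cauchy p.
  apply/asboolP => e e0; have [N1 h1] := uC e e0; have [N2 h2] := uq_small e e0.
  exists (maxn N1 N2) => m n; rewrite !geq_max => /andP[m1 m2] /andP[n1 n2].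
  rewrite -padic_abs_rat padic_of_ratB.
  rewrite (_ : _ - _ = (u m - u n) - (u m - padic_of_rat (q m)) +
    (u n - padic_of_rat (q n))); last by ring.
  by apply: padic_absD_lt; [apply: padic_absB_lt; [exact: h1|exact: h2]|exact: h2].
apply/cvg_ex; exists (\pi_Q_p (PadicSeq p_pr qC)); apply/padic_cvgP => e e0.
have [N1 h1] := uq_small e e0.
have /asboolP/(_ _ (divr_gt0 e0 (ltr0Sn _ 1)))[N2 h2] := qC.
exists (maxn N1 N2) => n; rewrite geq_max => /andP[n1 n2].
rewrite -(subrKA (padic_of_rat (q n))) padic_absD_lt//; last first.
  by rewrite padic_distC h1.
rewrite /padic_of_rat -(rmorphB \pi_Q_p).
apply: (@le_lt_trans _ _ (e / 2)); last by lra.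
apply: (@ler_cvg_to _ _ _ rat _ (fun=> e / 2) _ _ (@cvg_padic_abs _ _ _)).
  exact: cvg_cst.
exists N2 => // m /= Nm; rewrite -[X in ratpabs p X]/(q m - q n).
by rewrite ltW// h2.
Qed.

(** By the ultrametric inequality a block of terms is no larger than its largest term, so terms
    tending to 0 suffice. *)
Lemma padic_series_cvg (t : nat -> Q_p) :
  (forall e, 0 < e -> exists N, forall n, (N <= n)%N -> abs (t n) < e) ->
  cvgn (series t).
Proof.
move=> t0; apply: padic_complete => e e0; have [N hN] := t0 e e0.
suff tail n : (N <= n)%N -> abs (series t n - series t N) < e.
  exists N => m n Nm Nn; rewrite -(subrKA (series t N)).
  by rewrite padic_absD_lt ?tail// padic_distC tail.
move=> /subnKC <-; elim: (n - N)%N => [|k IH]; first by rewrite addn0 subrr padic_abs0.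
rewrite addnS seriesSr addrAC padic_absD_lt//.
by rewrite hN// leq_addr.
Qed.

Lemma padic_abs_lim_le (u v : nat -> Q_p) (a b d : Q_p) (B : rat) :
  u @ \oo --> a -> v @ \oo --> b ->
  (exists N, forall n, (N <= n)%N -> abs (u n - v n - d) <= B) ->
  abs (a - b - d) <= B.
Proof.
move=> /padic_cvgP ua /padic_cvgP vb [N hN]; rewrite leNgt; apply/negP => ltB.
(* The value assumed to exceed [B] is itself the precision: at a late index all three summands are
   below [e], whence [e < e]. *)
set e := abs (a - b - d) in ltB.
have e0 : 0 < e by apply: le_lt_trans ltB; exact: le_trans (padic_abs_ge0 _) (hN N _).
have [N1 h1] := ua e e0; have [N2 h2] := vb e e0.
pose n := maxn N (maxn N1 N2).
have nN : (N <= n)%N by rewrite leq_maxl.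
have n1 : (N1 <= n)%N by rewrite /n; lia.
have n2 : (N2 <= n)%N by rewrite /n; lia.
suff : abs (a - b - d) < e by rewrite ltxx.
rewrite (_ : _ - d = (a - u n) - (b - v n) + (u n - v n - d)); last by ring.
apply: padic_absD_lt; last exact: le_lt_trans (hN n nN) ltB.
by apply: padic_absB_lt; [exact: h1|exact: h2].
Qed.

(** * Powers and power series on the disk |x| <= 1/p *)

Lemma padic_abs1 : abs 1 = 1.
Proof. by have := padic_abs_nat 1 isT; rewrite logn1. Qed.

Lemma padic_absX (x : Q_p) n : abs (x ^+ n) = abs x ^+ n.
Proof.
elim: n => [|n IH]; first by rewrite !expr0 padic_abs1.
by rewrite !exprS padic_absM IH.
Qed.

Lemma padic_abs_subX_le (x y : Q_p) n : abs x <= r -> abs y <= r ->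
  abs (x ^+ n.+1 - y ^+ n.+1) <= abs (x - y) * r ^+ n.
Proof.
move=> xr yr; have r0 := padic_radius_gt0; elim: n => [|n IH].
  by rewrite !expr1 mulr1.
rewrite (_ : _ - _ = (x - y) * x ^+ n.+1 + y * (x ^+ n.+1 - y ^+ n.+1)); last first.
  by rewrite [x ^+ n.+2]exprS [y ^+ n.+2]exprS; ring.
rewrite padic_absD_le// padic_absM.
  by rewrite ler_wpM2l ?padic_abs_ge0// padic_absX lerXn2r// nnegrE ?padic_abs_ge0// ltW.
by rewrite [r ^+ n.+1]exprS [leRHS]mulrCA ler_pM ?padic_abs_ge0.
Qed.

Definition padic_pseries (c : nat -> Q_p) (x : Q_p) : Q_p :=
  limn (series (fun n => c n * x ^+ n)).

Section PowerSeries.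
Variable c : nat -> Q_p.
(** The exponent [n./2] is the bound on v_p((n+1)!), so that both 1/n! and the logarithm's
    coefficients qualify. *)
Hypothesis c_le : forall n, abs (c n.+1) * r ^+ n./2 <= 1.

(** Of the factor r^n gained from the powers, r^[n./2] pays for the coefficient and r^[uphalf n] is
    left. *)
Lemma padic_pseries_term_le (x y : Q_p) n : abs x <= r -> abs y <= r ->
  abs (c n.+1 * (x ^+ n.+1 - y ^+ n.+1)) <= abs (x - y) * r ^+ uphalf n.
Proof.
move=> xr yr; have r0 := padic_radius_gt0; rewrite padic_absM.
apply: (le_trans (ler_wpM2l (padic_abs_ge0 _) (padic_abs_subX_le _ _ n xr yr))).
rewrite mulrCA ler_wpM2l ?padic_abs_ge0//.
rewrite (_ : r ^+ n = r ^+ n./2 * r ^+ uphalf n).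
  by rewrite mulrA ler_piMl// exprn_ge0// ltW.
by rewrite -exprD; congr (_ ^+ _); lia.
Qed.

Lemma padic_pseries_cvg (x : Q_p) : abs x <= r ->
  series (fun n => c n * x ^+ n) @ \oo --> padic_pseries c x.
Proof.
move=> xr; apply: padic_series_cvg => e e0.
have [N Ne] := padic_radiusX_lt e e0; exists (N.*2).+1 => -[//|n] Nn.
(* Comparison with y = 0 turns the estimate on differences into one on a single term; n >= 2N makes
   [uphalf n] at least N. *)
rewrite (_ : x ^+ n.+1 = x ^+ n.+1 - 0 ^+ n.+1); last by rewrite expr0n subr0.
apply: le_lt_trans (padic_pseries_term_le x 0 n xr _) _.
  by rewrite padic_abs0 ltW// padic_radius_gt0.
apply: le_lt_trans Ne; rewrite subr0 -[leRHS]mul1r ler_pM ?padic_abs_ge0//.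
- by rewrite (le_trans xr)// ltW// padic_radius_lt1.
- by rewrite padic_radiusX_le//; lia.
Qed.

(** The terms of degree 0 and 1 cancel, and from degree 2 on [uphalf] is at least 1, which yields
    the factor r. *)
Lemma padic_pseries_linear_approx (x y : Q_p) : abs x <= r -> abs y <= r ->
  abs (padic_pseries c x - padic_pseries c y - c 1%N * (x - y)) <= abs (x - y) * r.
Proof.
move=> xr yr; apply: (padic_abs_lim_le _ _ _ _ _ _ (padic_pseries_cvg _ xr) (padic_pseries_cvg _ yr)).
exists 2%N => -[|[|n]]// _; rewrite /series/= -sumrB !big_nat_recl//.
rewrite !expr0 !expr1 subrr add0r -mulrBr addrAC subrr add0r.
apply: padic_abs_sum_le => [|i].
  by rewrite mulr_ge0 ?padic_abs_ge0// ltW// padic_radius_gt0.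
rewrite -mulrBr (le_trans (padic_pseries_term_le x y i.+1 xr yr))//.
by rewrite ler_wpM2l ?padic_abs_ge0// -[leRHS]expr1 padic_radiusX_le.
Qed.

Lemma padic_pseries_lipschitz (x y : Q_p) : abs x <= r -> abs y <= r ->
  abs (padic_pseries c x - padic_pseries c y) <= abs (x - y).
Proof.
move=> xr yr; rewrite -[X in abs X](subrK (c 1%N * (x - y))) padic_absD_le//.
  rewrite (le_trans (padic_pseries_linear_approx _ _ xr yr))//.
  by rewrite ler_piMr ?padic_abs_ge0// ltW// padic_radius_lt1.
by rewrite padic_absM ler_piMl ?padic_abs_ge0// (le_trans _ (c_le 0))//= mulr1.
Qed.

End PowerSeries.


(** * Exponential and logarithm on the disk *)

(** The radius of the disk is below 1, so discreteness improves the bound to 1/p. *)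
Lemma padic_exp_disk_le (R : realType) (x : Q_p) : padic_exp_disk R x -> abs x <= r.
Proof.
move=> /= xR; apply: padic_abs_discrete; rewrite -(ltr_rat R) rmorph1.
apply: (lt_trans xR); rewrite mulNr div1r powRN invf_lt1 ?powR_gt0 ?ltr0n ?prime_gt0//.
have p1 : (1 : R) < p%:R by rewrite ltr1n prime_gt1.
suff : 1 `^ (p%:R - 1)^-1 < p%:R `^ (p%:R - 1)^-1 :> R by rewrite powR1.
by apply: gt0_ltr_powR => //; rewrite ?nnegrE ?ler0n ?invr_gt0 ?subr_gt0.
Qed.

Section ExpLog.
Hypothesis p_gt2 : (2 < p)%N.

(** Makes the denominators exp g + exp h, which are congruent to 2 modulo p, units. *)
Lemma padic_abs2 : abs 2%:R = 1.
Proof. by rewrite padic_abs_nat// lognE gtnNdvd//= !andbF. Qed.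

Lemma padic_abs_logn_le n m : (0 < m)%N -> (logn p m <= n./2)%N ->
  abs m%:R^-1 * r ^+ n./2 <= 1.
Proof.
move=> m0 mn; have E := padic_abs_nat m m0.
have r0 := padic_radius_gt0; have rk : 0 < r ^+ logn p m by rewrite exprn_gt0.
have m1 : (m%:R : Q_p) != 0.
  by apply/eqP => mE; move: rk; rewrite -E mE padic_abs0 ltxx.
have -> : abs m%:R^-1 = (r ^+ logn p m)^-1.
  by apply: (mulfI (lt0r_neq0 rk)); rewrite -[in LHS]E -padic_absM !mulfV ?lt0r_neq0// padic_abs1.
by rewrite mulrC ler_pdivrMr// mul1r padic_radiusX_le.
Qed.

Let expc n : Q_p := (n`!)%:R^-1.
(* [logc 0] is [0], because [0^-1 = 0]. *)
Let logc n : Q_p := (-1) ^+ n.+1 / n%:R.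

Let expc_le n : abs (expc n.+1) * r ^+ n./2 <= 1.
Proof. by rewrite padic_abs_logn_le ?fact_gt0// logn_fact_le. Qed.

Let logc_le n : abs (logc n.+1) * r ^+ n./2 <= 1.
Proof.
rewrite padic_absM padic_absX padic_absN padic_abs1 expr1n mul1r.
(* As n+1 divides (n+1)!, the bound for factorials also covers the logarithm. *)
apply: padic_abs_logn_le => //; apply: leq_trans (logn_fact_le p n p_gt2 p_pr).
by rewrite dvdn_leq_log ?fact_gt0// dvdn_fact// leqnn.
Qed.

Let padic_expE (x : Q_p) : padic_exp x = padic_pseries expc x.
Proof.
rewrite /padic_exp; suff -> : (fun n => x ^+ n / n`!%:R) = (fun n => expc n * x ^+ n) by [].
by apply/funext => n; rewrite mulrC.
Qed.

Let padic_logE (x : Q_p) : padic_log x = padic_pseries logc (x - 1).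
Proof.
rewrite /padic_log (_ : (fun N => _) = series (fun n => logc n * (x - 1) ^+ n))//.
apply/funext => -[|N]; first by rewrite /series /= !big_geq.
rewrite /series /= [RHS]big_nat_recl// /logc invr0 mulr0 mul0r add0r big_add1 /=.
by apply: eq_bigr => n _; rewrite [RHS]mulrAC mulrA.
Qed.

Lemma padic_exp_linear_approx (x y : Q_p) : abs x <= r -> abs y <= r ->
  abs (padic_exp x - padic_exp y - (x - y)) <= abs (x - y) * r.
Proof.
move=> xr yr; have := padic_pseries_linear_approx _ expc_le x y xr yr.
by rewrite -!padic_expE /expc invr1 mul1r.
Qed.

Lemma padic_exp_lipschitz (x y : Q_p) : abs x <= r -> abs y <= r ->
  abs (padic_exp x - padic_exp y) <= abs (x - y).
Proof. by rewrite !padic_expE; exact: padic_pseries_lipschitz. Qed.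

Lemma padic_exp0 : padic_exp (0 : Q_p) = 1.
Proof.
rewrite padic_expE; apply: cvg_lim; first exact: metric_hausdorff.
apply/padic_cvgP => e e0; exists 1%N => -[//|n] _.
rewrite /series /= big_nat_recl// expr0 mulr1 /expc invr1 big1 => [|i _].
  by rewrite addr0 subrr padic_abs0.
by rewrite expr0n mulr0.
Qed.

Lemma padic_exp_sub1_le (x : Q_p) : abs x <= r -> abs (padic_exp x - 1) <= r.
Proof.
move=> xr; rewrite -padic_exp0; apply: le_trans (padic_exp_lipschitz _ _ xr _) _.
  by rewrite padic_abs0 ltW// padic_radius_gt0.
by rewrite subr0.
Qed.

Lemma padic_log_lipschitz (x y : Q_p) : abs (x - 1) <= r -> abs (y - 1) <= r ->
  abs (padic_log x - padic_log y) <= abs (x - y).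
Proof.
move=> xr yr; rewrite !padic_logE.
rewrite (le_trans (padic_pseries_lipschitz _ logc_le _ _ xr yr))//.
by rewrite opprB addrA subrK.
Qed.

Lemma padic_abs_sum_units (x y : Q_p) : abs (x - 1) <= r -> abs (y - 1) <= r ->
  abs (x + y) = 1.
Proof.
move=> xr yr; rewrite -padic_abs2; apply: padic_abs_close; rewrite padic_abs2.
rewrite (_ : _ - _ = (x - 1) + (y - 1)); last by ring.
by apply: le_lt_trans padic_radius_lt1; exact: padic_absD_le.
Qed.

Lemma padic_abs_unit (x : Q_p) : abs (x - 1) <= r -> abs x = 1.
Proof.
move=> xr; rewrite -padic_abs1; apply: padic_abs_close; rewrite padic_abs1.
exact: le_lt_trans padic_radius_lt1.
Qed.

Lemma padic_abs_div1 (x y : Q_p) : abs y = 1 -> abs (x / y) = abs x.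
Proof.
move=> y1; have y0 : y != 0.
  by apply/eqP => yE; move: y1; rewrite yE padic_abs0 => /esym/eqP; rewrite oner_eq0.
by rewrite -[x in RHS](divfK y0) [RHS]padic_absM y1 mulr1.
Qed.

(** * The fractional factor as a contraction into 1 + p Z_p *)

Definition padic_factor (a b g h : Q_p) : Q_p :=
  (padic_exp (a + h) + padic_exp b) / (padic_exp g + padic_exp h).

Section Factor.
Variables a b g : Q_p.
Hypotheses (ar : abs a <= r) (br : abs b <= r) (gr : abs g <= r).

Lemma padic_factor_sub1_le h : abs h <= r -> abs (padic_factor a b g h - 1) <= r.
Proof.
move=> hr; rewrite /padic_factor; set A := padic_exp (a + h); set B := padic_exp b.
set C := padic_exp g; set D := padic_exp h.
have Ar : abs (A - 1) <= r by rewrite padic_exp_sub1_le// padic_absD_le.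
have [Br Cr Dr] : [/\ abs (B - 1) <= r, abs (C - 1) <= r & abs (D - 1) <= r].
  by split; exact: padic_exp_sub1_le.
have CD := padic_abs_sum_units C D Cr Dr.
have CD0 : C + D != 0.
  by apply/eqP => E; move: CD; rewrite E padic_abs0 => /esym/eqP; rewrite oner_eq0.
(* Over the unit denominator, the numerator A + B - (C + D) is a combination of four elements of p
   Z_p. *)
rewrite -[X in _ - X](divff CD0) -mulrBl padic_abs_div1//.
rewrite (_ : _ - _ = (A - 1) + (B - 1) - ((C - 1) + (D - 1))); last by ring.
by rewrite padic_absB_le// padic_absD_le.
Qed.

(* With A = exp (a + h), B = exp b, D = exp h, C = exp g, and A', D' the values at
   h', the numerator of the difference is (A - A') (C + D') - (A' + B) (D - D').
   Both A - A' and D - D' are h - h' up to r |h - h'|, and C + D' is A' + B up to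
   r, so the leading terms cancel and a factor r is gained. *)
Lemma padic_factor_contract h h' : abs h <= r -> abs h' <= r ->
  abs (padic_factor a b g h - padic_factor a b g h') <= abs (h - h') * r.
Proof.
move=> hr hr'; rewrite /padic_factor.
have ahr : abs (a + h) <= r by exact: padic_absD_le.
have ahr' : abs (a + h') <= r by exact: padic_absD_le.
have := padic_exp_linear_approx _ _ hr hr'.
have := padic_exp_linear_approx _ _ ahr ahr'.
rewrite (_ : a + h - (a + h') = h - h'); last by ring.
have := (padic_exp_sub1_le _ ahr, padic_exp_sub1_le _ ahr').
have := (padic_exp_sub1_le _ hr, padic_exp_sub1_le _ hr').
have := (padic_exp_sub1_le _ br, padic_exp_sub1_le _ gr).
move: (padic_exp (a + h)) (padic_exp (a + h')) (padic_exp h) (padic_exp h').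
move: (padic_exp b) (padic_exp g) => B C A A' D D'.
move=> [Br Cr] [Dr Dr'] [Ar Ar'] dA dD; set d := h - h' in dA dD *.
have nz x : abs x = 1 -> x != 0.
  by move=> x1; apply/eqP => E; move: x1; rewrite E padic_abs0 => /esym/eqP; rewrite oner_eq0.
have CD := padic_abs_sum_units C D Cr Dr; have CD' := padic_abs_sum_units C D' Cr Dr'.
have AB' := padic_abs_sum_units A' B Ar' Br.
rewrite sub_mediants ?nz//.
rewrite padic_abs_div1 ?padic_absM ?CD ?CD' ?mulr1//.
rewrite (_ : _ - _ = (A - A' - d) * (C + D') - (A' + B) * (D - D' - d)
   + d * ((C - 1) + (D' - 1) - ((A' - 1) + (B - 1)))); last by ring.
apply: padic_absD_le.
  by apply: padic_absB_le; rewrite padic_absM ?CD' ?AB' ?mulr1 ?mul1r.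
rewrite padic_absM ler_wpM2l ?padic_abs_ge0//.
by rewrite padic_absB_le// padic_absD_le.
Qed.

End Factor.

Lemma padic_mul_sub1_le (x y : Q_p) : abs (x - 1) <= r -> abs (y - 1) <= r ->
  abs (x * y - 1) <= r.
Proof.
move=> xr yr; rewrite (_ : _ - 1 = (x - 1) * y + (y - 1)); last by ring.
by rewrite padic_absD_le// padic_absM (padic_abs_unit y yr) mulr1.
Qed.

(** Changing one factor at a time leaves the other as a unit multiplier, so the product varies no
    more than its factors. *)
Lemma padic_abs_subM_le (x y x' y' : Q_p) e : abs x = 1 -> abs y' = 1 ->
  abs (x - x') <= e -> abs (y - y') <= e -> abs (x * y - x' * y') <= e.
Proof.
move=> x1 y1 xe ye; rewrite (_ : _ - _ = x * (y - y') + (x - x') * y'); last by ring.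
by rewrite padic_absD_le// padic_absM ?x1 ?y1 ?mul1r ?mulr1.
Qed.

End ExpLog.
End PadicAbs.

(** * Uniqueness of the solution *)

Theorem theorem2p2 (R : realType) (p : nat) (p_pr : prime p) (p_ge3 : (3 <= p)%N)
    (alpha beta gamma : nat -> padic p_pr)
    (halpha : forall k, padic_exp_disk R (alpha k))
    (hbeta : forall k, padic_exp_disk R (beta k))
    (hgamma : forall k, padic_exp_disk R (gamma k)) :
  let S := [set h : nat -> padic p_pr |
    (forall n, padic_exp_disk R (h n)) /\
    (forall n, h n = padic_log
      ((padic_exp (alpha n.+1 + h n.+1) + padic_exp (beta n.+1)) /
         (padic_exp (gamma n.+1) + padic_exp (h n.+1)) *
       ((padic_exp (alpha n.+2 + h n.+2) + padic_exp (beta n.+2)) /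
         (padic_exp (gamma n.+2) + padic_exp (h n.+2)))))] in
  S #<= `I_1.
Proof.
lazy zeta; set S := [set h | _].
have ar k := padic_exp_disk_le R _ (halpha k).
have br k := padic_exp_disk_le R _ (hbeta k).
have gr k := padic_exp_disk_le R _ (hgamma k).
suff S_unique h h' : S h -> S h' -> h' = h.
  have [-> |/set0P[h Sh]] := eqVneq S set0; first exact: card_ge0.
  apply: (@card_le_trans _ _ _ [set h]); last by have /card_eqPle[] := @card_set1 _ h.
  by apply: subset_card_le => h' Sh' /=; exact: S_unique.
pose F (k : nat -> padic p_pr) m := padic_factor (alpha m) (beta m) (gamma m) (k m).
have SE k : S k -> (forall m, padic_abs (k m) <= p%:R^-1) /\
    (forall m, k m = padic_log (F k m.+1 * F k m.+2)).
  by case=> kD kE; split=> // m; exact: padic_exp_disk_le (kD m).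
move=> /SE[hr hE] /SE[hr' hE'].
have Fr k m : (forall i, padic_abs (k i) <= p%:R^-1) -> padic_abs (F k m - 1) <= p%:R^-1.
  by move=> kr; exact: padic_factor_sub1_le.
(* The bound is uniform in [n], since the recursion calls it at n+1 and n+2. Both sequences lie in
   the disk, which gives the base case [k = 0]. *)
have close k n : padic_abs (h' n - h n) <= p%:R^-1 ^+ k.+1.
  elim: k n => [|k IH] n; first by rewrite expr1 padic_absB_le.
  have FF m : padic_abs (F h' m - F h m) <= p%:R^-1 ^+ k.+2.
    apply: le_trans (padic_factor_contract p_ge3 _ _ _ _ _ _ _ _ _ _) _ => //.
    by rewrite [leRHS]exprSr ler_wpM2r ?IH// ltW// (padic_radius_gt0 (p_pr := p_pr)).
  rewrite hE hE'; apply: le_trans (padic_log_lipschitz p_ge3 _ _ _ _) _.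
  - by apply: padic_mul_sub1_le; exact: Fr.
  - by apply: padic_mul_sub1_le; exact: Fr.
  - by apply: padic_abs_subM_le => //; apply: padic_abs_unit; exact: Fr.
apply/funext => n; apply/eqP; rewrite -subr_eq0; apply/eqP/padic_abs_eq0/eqP.
(* A positive distance would exceed some r^k, against [close]. *)
rewrite eq_le padic_abs_ge0 andbT leNgt; apply/negP => /(padic_radiusX_lt (p_pr := p_pr)).
move=> [k]; rewrite ltNge => /negP; apply; apply: le_trans (close k n) _.
exact: (padic_radiusX_le (p_pr := p_pr)).
Qed.
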